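(* Let $G$ be a connected $(0,\ell)$-graph that is not a tree. Then $2\le \sigma_T(G)\le 2\ell-1$.
   Context: All graphs are finite and simple. A $(0,\ell)$-graph is a graph whose vertex set can be partitioned into $\ell$ cliques. A tree $t$-spanner of a connected graph $G$ is a spanning tree $T$ of $G$ such that $d_T(u,v)\le t$ for every edge $uv$ of $G$. The stretch index $\sigma_T(G)$ is the smallest $t$ such that $G$ has a tree $t$-spanner.
   Formalization: The assumption ℓ ≥ 2 is added: for ℓ = 1 the claim fails, since K_3 is a connected (0,1)-graph that is not a tree and has stretch index 2 > 1; for ℓ = 0 there is no nonempty graph. *)

(* Defs.v *)
From mathcomp Require Import all_boot.
From mathcomp Require Import boolp.

Set Implicit Arguments.
Unset Strict Implicit.
Unset Printing Implicit Defensive.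

Record sgraph (V : finType) := SGraph {
  adj :> rel V;
  adj_sym : symmetric adj;
  adj_irrefl : irreflexive adj }.

(* The least natural number satisfying P, and 0 if there is none. *)
Definition least (P : nat -> Prop) : nat :=
  if pselect (exists n, `[< P n >]) is left exP then ex_minn exP else 0.

Lemma leastP (P : nat -> Prop) (n : nat) :
  P n -> P (least P) /\ (forall m, P m -> least P <= m).
Proof.
move=> Pn; rewrite /least; case: pselect => [exP|[]]; last first.
  by exists n; apply/asboolP.
by case: ex_minnP => k /asboolP Pk kmin; split=> // m /asboolP/kmin.
Qed.

Section Graphs.
Variable V : finType.
Implicit Types G T : sgraph V.

(* The graph without vertices is not regarded as connected. *)
Definition connected G : Prop :=
  0 < #|V| /\ forall u v : V, connect G u v.

(* [ucycle] allows degenerate closed paths x, y, x (size 2); genuine cycles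
   are those of size at least 3. *)
Definition acyclic G : Prop :=
  forall c : seq V, ucycle G c -> size c <= 2.

Definition is_tree G : Prop := connected G /\ acyclic G.

Definition dist G (u v : V) : nat :=
  least (fun n => exists p : seq V,
    [/\ path G u p, last u p = v & size p = n]).

(* T has the same vertex type as G, so it is automatically spanning. *)
Definition spanning_tree T G : Prop := is_tree T /\ subrel T G.

Definition tree_spanner (t : nat) T G : Prop :=
  spanning_tree T G /\ forall u v : V, G u v -> dist T u v <= t.

Definition stretch_index G : nat :=
  least (fun t => exists T, tree_spanner t T G).

Definition clique G (K : {set V}) : Prop :=
  {in K &, forall x y, x != y -> G x y}.

(* Blocks of [partition] are nonempty; "at most l" blocks amounts to l cliques
   some of which may be empty. *)
Definition zero_l_graph (l : nat) G : Prop :=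
  exists P : {set {set V}},
    [/\ partition P [set: V], #|P| <= l & {in P, forall K, clique G K}].

End Graphs.

(* Main.v *)
(** A connected graph partitioned into [l >= 2] cliques even has a spanning
    tree of diameter at most [2 * l - 1].  Choose an edge [a b] between two
    cliques; the double star with centers [a] and [b] spans these two cliques
    and has diameter at most 3.  As long as some clique is missed, some edge
    [a b] leaves the current tree; attaching the clique of [b] to [a] as a star
    centered at [b] raises the diameter by at most 2.  For the lower bound, if
    every edge of [G] joins vertices at distance at most 1 in a spanning tree
    [T], then [G = T] is a tree. *)
Require Import Defs.
From mathcomp Require Import all_boot.
From mathcomp Require Import boolp.

Set Implicit Arguments.
Unset Strict Implicit.
Unset Printing Implicit Defensive.

(** * Walks of bounded length *)

Section Within.
Variable V : finType.
Implicit Types (T : sgraph V) (x y z : V).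

(** Unlike [dist T x y <= n], this bound also asserts that a walk exists: [dist] is 0 by default
    between disconnected vertices. *)
Definition within T n x y : Prop :=
  exists p, [/\ path T x p, last x p = y & size p <= n].

Lemma within_refl T n x : within T n x x.
Proof. by exists [::]. Qed.

Lemma within_edge T x y : T x y -> within T 1 x y.
Proof. by move=> Txy; exists [:: y]; split=> //=; rewrite Txy. Qed.

Lemma within_leq T m n x y : m <= n -> within T m x y -> within T n x y.
Proof. by move=> le_mn [p [? ? /leq_trans le_p]]; exists p; split; auto. Qed.

Lemma within_trans T m n x y z :
  within T m x y -> within T n y z -> within T (m + n) x z.
Proof.
move=> [p [Tp lp sp]] [q [Tq lq sq]]; exists (p ++ q); split.
- by rewrite cat_path Tp lp.
- by rewrite last_cat lp.
- by rewrite size_cat leq_add.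
Qed.

Lemma within_sym T n x y : within T n x y -> within T n y x.
Proof.
move=> [p [Tp <- sp]]; exists (rev (belast x p)); split.
- by rewrite rev_path (eq_path (e' := T)) // => u v; rewrite /= adj_sym.
- by case: p {Tp sp} => //= z p; rewrite rev_cons last_rcons.
- by rewrite size_rev size_belast.
Qed.

Lemma within_sub T T' n x y : subrel T T' -> within T n x y -> within T' n x y.
Proof. by move=> sTT' [p [/(sub_path sTT') ? ? ?]]; exists p. Qed.

Lemma dist_within T n x y : within T n x y -> dist T x y <= n.
Proof.
move=> [p [Tp lp sp]]; apply: leq_trans sp.
by apply: (leastP _).2; [exact: (ex_intro _ p) | exists p].
Qed.

Lemma within_dist T x y : connect T x y -> within T (dist T x y) x y.
Proof.
case/connectP=> p Tp lp.
have [|[q [Tq lq sq]] _] := @leastP (fun n => exists q : seq V,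
  [/\ path T x q, last x q = y & size q = n]) (size p); first by exists p.
by exists q; split=> //; rewrite sq.
Qed.

End Within.

(** * Growing trees inside [G] by leaves and by cliques *)

Section Grow.
Variables (V : finType) (G : sgraph V).
Implicit Types (T : sgraph V) (S L K : {set V}).

(** [T] lives on all of [V], with the vertices outside [S] isolated. Connectedness on [S] is
    supplied separately by [diam_le]. *)
Definition forest_on S T : Prop :=
  [/\ subrel T G, acyclic T & forall x y, T x y -> x \in S].

Definition ecc_le T S a n : Prop := {in S, forall x, within T n x a}.

Definition diam_le T S n : Prop := {in S &, forall x y, within T n x y}.

Lemma forest_on_set1 c : exists2 T, forest_on [set c] T & diam_le T [set c] 0.
Proof.
have e_sym : symmetric (fun _ _ : V => false) by [].
exists (SGraph e_sym (fun _ => erefl)); last first.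
  by move=> x y /set1P-> /set1P->; apply: within_refl.
by split=> // -[|x [|y c']] //= /andP[].
Qed.

(** Each new vertex has [a] as its only neighbour, so a cycle of size at least 3 avoids [L] and is
    already a cycle of [T]. *)
Lemma add_leaves S T L a :
    forest_on S T -> a \in S -> [disjoint S & L] -> {in L, forall v, G a v} ->
  exists T', [/\ forest_on (S :|: L) T', subrel T T' &
                 {in L, forall v, T' a v}].
Proof.
move=> [TG Tac TS] aS dSL GL.
have LS v : v \in L -> v \notin S by move=> vL; rewrite (disjointFl dSL vL).
pose e := [rel x y | [|| T x y, (x == a) && (y \in L) | (y == a) && (x \in L)]].
have e_sym : symmetric e.
  by move=> x y; rewrite /= adj_sym [X in _ || X]orbC.
have e_irr : irreflexive e.
  move=> x; rewrite /= adj_irrefl /= orbb; apply/andP=> -[/eqP-> /LS].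
  by rewrite aS.
have e_leaf v x : v \in L -> e v x -> x = a.
  move=> vL /or3P[/TS||/andP[/eqP]//]; first by rewrite (negPf (LS v vL)).
  by case/andP=> /eqP va; rewrite -va (negPf (LS v vL)) in aS.
exists (SGraph e_sym e_irr); split.
- split.
  + move=> x y /= /or3P[/TG//|/andP[/eqP-> /GL]//|/andP[/eqP-> /GL]].
    by rewrite adj_sym.
  + move=> c /andP[/= ec uc]; rewrite leqNgt; apply/negP=> c_gt2.
    have [/hasP[v vc vL]|/hasPn cL] := boolP (has (mem L) c).
      (* The two neighbours of a leaf on the cycle would both be [a]. *)
      case/rot_to: vc => i c' rc.
      have := c_gt2; have := uc; have := ec.
      rewrite -(rot_cycle i) -(rot_uniq i) -(size_rot i) rc.
      case: c' {rc} => [|x c'] //; case/lastP: c' => [|c' y] //.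
      rewrite /= rcons_path last_rcons => /and3P[/(e_leaf _ _ vL)-> _].
      rewrite e_sym => /(e_leaf _ _ vL)->.
      by rewrite mem_rcons mem_head /= andbF.
    suff /Tac : ucycle T c by rewrite leqNgt c_gt2.
    rewrite /ucycle uc andbT.
    apply: (sub_in_cycle (P := [pred v | v \notin L])) ec.
      move=> x y; rewrite !inE => /negPf xL /negPf yL.
      by rewrite /= xL yL !andbF !orbF.
    by apply/allP=> v /cL.
  + move=> x y /or3P[/TS||]; rewrite inE; first by move->.
      by case/andP=> /eqP->; rewrite aS.
    by case/andP=> _ ->; rewrite orbT.
- by move=> x y /= ->.
- by move=> v vL /=; rewrite eqxx vL orbT.
Qed.

(** A walk from or to a new leaf passes through [a], at the cost of one edge plus the new
    eccentricity of [a]. *)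
Lemma add_leaves_diam S T L a m n :
    forest_on S T -> a \in S -> [disjoint S & L] -> {in L, forall v, G a v} ->
    ecc_le T S a m -> diam_le T S n ->
  exists T', [/\ forest_on (S :|: L) T', {in L, forall v, T' a v},
    ecc_le T' (S :|: L) a (maxn m 1) &
    diam_le T' (S :|: L) (maxn n (maxn m 1).+1)].
Proof.
move=> fT aS dSL GL Tm Tn; have [T' [fT' TT' La]] := add_leaves fT aS dSL GL.
have near v : v \in L -> within T' 1 v a.
  by move=> /La/within_edge/within_sym.
have T'm : ecc_le T' (S :|: L) a (maxn m 1).
  move=> x /setUP[/Tm/(within_sub TT')|/near];
    by apply: within_leq; rewrite ?leq_maxl ?leq_maxr.
exists T'; split=> // x y xSL ySL.
have [yL|yL] := boolP (y \in L).
  apply: within_leq (leq_maxr _ _) _; rewrite -addn1.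
  exact: within_trans (T'm x xSL) (within_sym (near y yL)).
have [xL|xL] := boolP (x \in L).
  apply: within_leq (leq_maxr _ _) _; rewrite -add1n.
  exact: within_trans (near x xL) (within_sym (T'm y ySL)).
move: xSL ySL; rewrite !inE (negPf xL) (negPf yL) !orbF => xS yS.
exact: within_leq (leq_maxl _ _) (within_sub TT' (Tn x y xS yS)).
Qed.

Lemma clique_star K c : clique G K -> c \in K ->
  exists T, [/\ forest_on K T, ecc_le T K c 1 & diam_le T K 2].
Proof.
move=> cK Kc; have [T0 fT0 dT0] := forest_on_set1 c.
have [|v|x xc|T [fT _ Te Td]] :=
  @add_leaves_diam _ _ (K :\ c) _ 0 _ fT0 (set11 c) _ _ _ dT0.
- by rewrite disjoints1 !inE eqxx.
- by rewrite !inE eq_sym => /andP[cv Kv]; apply: cK.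
- exact: dT0 (set11 c).
by exists T; rewrite setD1K in fT Te Td.
Qed.

(** First [b] is hung on [a], then the rest of [K] on [b]. The eccentricity of [b] is at most
    [m.+1], so the leaves at [b] reach everything within [m.+2]. *)
Lemma add_clique S T K a b m n :
    forest_on S T -> a \in S -> clique G K -> [disjoint S & K] -> b \in K ->
    G a b -> ecc_le T S a m -> diam_le T S n -> 0 < m ->
  exists2 T', forest_on (S :|: K) T' & diam_le T' (S :|: K) (maxn n m.+2).
Proof.
move=> fT aS cK dSK Kb Gab Tm Tn m_gt0.
have SK v : v \in K -> v \notin S by move=> vK; rewrite (disjointFl dSK vK).
have [|v|T1 [fT1 T1b T1m T1n]] :=
  @add_leaves_diam _ _ [set b] _ _ _ fT aS _ _ Tm Tn.
- by rewrite disjoint_sym disjoints1 SK.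
- by move/set1P->.
rewrite (maxn_idPl m_gt0) in T1m T1n.
have b1 : b \in S :|: [set b] by rewrite !inE eqxx orbT.
have T1e : ecc_le T1 (S :|: [set b]) b m.+1.
  move=> x /T1m xa; rewrite -addn1; apply: within_trans xa _.
  exact/within_edge/T1b/set11.
have [|v|T2 [fT2 _ _ T2n]] :=
  @add_leaves_diam _ _ (K :\ b) _ _ _ fT1 b1 _ _ T1e T1n.
- rewrite -setI_eq0; apply/eqP/setP=> v; rewrite !inE.
  case: eqP => [->|_]; rewrite ?andbF //= orbF.
  by apply/andP=> -[vS /SK]; rewrite vS.
- by rewrite !inE eq_sym => /andP[bv Kv]; apply: cK.
rewrite -setUA setD1K // in fT2 T2n; exists T2 => // x y xS yS.
apply: within_leq (T2n x y xS yS).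
have -> : maxn m.+1 1 = m.+1 by apply/maxn_idPl.
by rewrite -maxnA (maxn_idPr (leqnSn m.+1)).
Qed.

(** Without such an edge [S] would be closed under adjacency, hence a union of components. *)
Lemma crossing_edge S : connected G -> S != set0 -> S != [set: V] ->
  exists a b, [/\ a \in S, b \notin S & G a b].
Proof.
move=> [_ Gc] /set0Pn[x xS] SV.
have [y yS] : exists y, y \notin S.
  apply/existsP; apply: contraNT SV; rewrite negb_exists => /forallP S_all.
  by apply/eqP/setP=> y; rewrite inE; apply/negbNE.
have [/existsP[a /existsP[b /and3P[]]]|noE] :=
    boolP [exists a, exists b, [&& a \in S, b \notin S & G a b]].
  by exists a, b.
have clS : closed G S.
  apply: intro_closed => [|a b Gab aS]; first exact/sym_connect_sym/adj_sym.
  apply: contraNT noE => bS; apply/existsP; exists a; apply/existsP; exists b.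
  by rewrite aS bS.
by move: (closed_connect clS (Gc x y)); rewrite xS (negPf yS).
Qed.

End Grow.

(** * Absorbing the cliques of the partition one by one *)

Section Cliques.
Variables (V : finType) (G : sgraph V) (P : {set {set V}}).
Hypotheses (G_conn : connected G) (P_part : partition P [set: V]).
Hypothesis P_clique : {in P, forall K, clique G K}.
Implicit Types Q : {set {set V}}.

Lemma cover_sub_eqT Q : Q \subset P -> cover Q = [set: V] -> Q = P.
Proof.
case/and3P: P_part => _ tP P0 QP QV; apply/eqP; rewrite eqEsubset QP.
apply/subsetP=> K KP; have /set0Pn[x xK] : K != set0.
  by apply: contraNneq P0 => <-.
have /bigcupP[K' K'Q xK'] : x \in cover Q by rewrite QV inE.
have K'P := subsetP QP _ K'Q.
by rewrite -(def_pblock tP KP xK) (def_pblock tP K'P xK').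
Qed.

(** The block of the outer end [b] of a crossing edge is not in [Q], and distinct blocks are
    disjoint, so it misses the whole cover. *)
Lemma missed_clique Q : Q \subset P -> Q != set0 -> Q != P ->
  exists a b (K : {set V}), [/\ a \in cover Q, b \in K, G a b,
    K \in P :\: Q & [disjoint cover Q & K]].
Proof.
case/and3P: (P_part) => /eqP cP tP P0 QP /set0Pn[K0 K0Q] neQP.
have [||a [b [aS bS Gab]]] := @crossing_edge V G (cover Q) G_conn.
- have /set0Pn[x xK0] : K0 != set0.
    by apply: contraNneq P0 => <-; apply: (subsetP QP).
  by apply/set0Pn; exists x; apply/bigcupP; exists K0.
- by apply: contra_neq neQP; apply: cover_sub_eqT.
have bP : b \in cover P by rewrite cP inE.
have KP := pblock_mem bP; have bK : b \in pblock P b by rewrite mem_pblock.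
have KQ : pblock P b \notin Q.
  by apply: contra bS => KQ; apply/bigcupP; exists (pblock P b).
exists a, b, (pblock P b); split; rewrite ?inE ?KQ //.
rewrite -setI_eq0; apply/eqP/setP=> v; rewrite !inE.
apply/andP=> -[/bigcupP[K' K'Q vK'] vK]; case/negP: KQ.
by rewrite -(def_pblock tP KP vK) (def_pblock tP (subsetP QP _ K'Q) vK').
Qed.

Lemma cover_setU1 Q K : cover (K |: Q) = cover Q :|: K.
Proof. by rewrite /cover bigcup_setU big_set1 setUC. Qed.

Lemma spanning_cliques k : k.+2 <= #|P| ->
  exists Q T, [/\ Q \subset P, #|Q| = k.+2, forest_on G (cover Q) T &
    diam_le T (cover Q) (k.*2 + 3)].
Proof.
elim: k => [|k IHk] leP.
  have /card_gt0P[K0 K0P] : 0 < #|P| by apply: leq_trans leP.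
  have cov0 : cover [set K0] = K0 by rewrite /cover big_set1.
  have [|||a [b [K [aS Kb Gab]]]] := @missed_clique [set K0].
  - by rewrite sub1set.
  - by apply/set0Pn; exists K0; apply: set11.
  - by apply: contraTneq leP => <-; rewrite cards1.
  rewrite cov0 in aS *; case/setDP=> KP KQ dSK.
  (* The star is centered at the end [a] of the crossing edge chosen before: eccentricity 1 there
     yields diameter 3 for two cliques. *)
  have [T [fT Te Td]] := clique_star (P_clique K0P) aS.
  have [//|T' fT' Td'] := add_clique fT aS (P_clique KP) dSK Kb Gab Te Td.
  exists (K |: [set K0]), T'; rewrite cover_setU1 cov0; split=> //.
    by rewrite subUset !sub1set KP.
  by rewrite cardsU1 KQ cards1.
have [Q [T [QP cQ fT Td]]] := IHk (ltnW leP).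
have [|||a [b [K [aS Kb Gab]]]] := @missed_clique Q => //.
- by rewrite -card_gt0 cQ.
- by apply: contraTneq leP => <-; rewrite cQ ltnn.
case/setDP=> KP KQ dSK.
(* From now on the diameter itself bounds the eccentricity of [a], so each clique costs 2. *)
have Te : ecc_le T (cover Q) a (k.*2 + 3) by move=> x xS; apply: Td.
have [|T' fT' Td'] := add_clique fT aS (P_clique KP) dSK Kb Gab Te Td.
  by rewrite addn3.
exists (K |: Q), T'; rewrite cover_setU1; split=> //.
- by rewrite subUset sub1set KP.
- by rewrite cardsU1 KQ cQ.
by rewrite (maxn_idPr (leqW (leqnSn _))) in Td'.
Qed.

(** The 2 in the maximum accounts for a single clique, where the star has diameter up to 2 but
    [2 * #|P| - 1] is 1. *)
Lemma spanning_forest_diam : exists T,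
  forest_on G [set: V] T /\ diam_le T [set: V] (maxn 2 (2 * #|P| - 1)).
Proof.
case/and3P: (P_part) => /eqP cP _ _.
have [gt1|le1] := ltnP 1 #|P|.
  have kP : (#|P| - 2).+2 = #|P| by rewrite -addn2 subnK.
  have [|Q [T [QP cQ fT Td]]] := @spanning_cliques (#|P| - 2).
    by rewrite kP.
  have QE : Q = P by apply/eqP; rewrite eqEcard QP cQ kP leqnn.
  rewrite QE cP in fT Td; exists T; split=> // x y xV yV.
  apply: within_leq (Td x y xV yV).
  by rewrite leq_max -{3}kP mul2n !doubleS subn1 /= addn3 leqnn orbT.
have [/card_gt0P[c _] _] := G_conn.
have /bigcupP[K KP Kc] : c \in cover P by rewrite cP inE.
have PE : P = [set K].
  by apply/esym/eqP; rewrite eqEcard sub1set KP cards1.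
have [T [fT _ Td]] := clique_star (P_clique KP) Kc.
have KV : K = [set: V] by rewrite -cP PE /cover big_set1.
rewrite KV in fT Td; exists T; split=> // x y xV yV.
exact: within_leq (leq_maxl _ _) (Td x y xV yV).
Qed.

End Cliques.

(** * From spanning trees to bounds on the stretch index *)

Lemma forest_tree_spanner (V : finType) (G T : sgraph V) (n : nat) :
  0 < #|V| -> forest_on G [set: V] T -> diam_le T [set: V] n ->
  tree_spanner n T G.
Proof.
move=> V_gt0 [TG Tac _] Td; have dT x y : within T n x y by apply: Td.
split=> [|x y _]; last exact: dist_within.
split=> //; split=> //; split=> // x y.
by case: (dT x y) => p [Tp lp _]; apply/connectP; exists p.
Qed.

Lemma tree_spanner1_is_tree (V : finType) (t : nat) (T G : sgraph V) :
  tree_spanner t T G -> t <= 1 -> is_tree G.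
Proof.
move=> [[[[V_gt0 Tc] Tac] TG] Tt] le1; have GT : subrel G T.
  move=> x y Gxy.
  (* A shortest walk in [T] has length at most 1. Length 0 would make [x y] a loop of [G]; length 1
     is an edge of [T]. *)
  have [[|z [|? ?]] [/= Tp lp sp]] := within_dist (Tc x y).
  - by rewrite lp adj_irrefl in Gxy.
  - by rewrite -lp; case/andP: Tp.
  - by have := leq_trans sp (leq_trans (Tt x y Gxy) le1).
split; first split=> // x y.
  by apply: connect_sub (Tc x y) => u v /TG/connect1.
by move=> c /andP[/(sub_cycle GT) Tcyc uc]; apply: Tac; apply/andP.
Qed.

Theorem theorem8 (V : finType) (G : sgraph V) (l : nat)
  (l_ge2 : 2 <= l)
  (G_conn : connected G)
  (G_0l : zero_l_graph l G)
  (G_not_tree : ~ is_tree G) :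
  2 <= stretch_index G <= 2 * l - 1.
Proof.
have [P [P_part le_Pl P_clique]] := G_0l.
have [T [fT Td]] := spanning_forest_diam G_conn P_part P_clique.
(* Since [l >= 2], the bound [2 * l - 1] is at least 3 and absorbs the 2. *)
have le_d : maxn 2 (2 * #|P| - 1) <= 2 * l - 1.
  rewrite geq_max leq_sub2r ?leq_mul2l ?le_Pl ?orbT // andbT.
  by rewrite ltn_subRL (leq_trans (_ : 2 < 2 * 2)) // leq_mul2l.
have Tspan := forest_tree_spanner G_conn.1 fT Td.
(* The spanner just built ensures that the stretch index is an attained minimum and not the default
   0. *)
have [|[T' spanT'] least_le] := @leastP
  (fun t => exists T, tree_spanner t T G) (maxn 2 (2 * #|P| - 1)).
  by exists T.
apply/andP; split; last by apply: leq_trans le_d; apply: least_le; exists T.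
rewrite ltnNge; apply/negP=> le1; apply: G_not_tree.
exact: tree_spanner1_is_tree spanT' le1.
Qed.
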